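(* For any $t>0$: (A) there exist one-dimensional, unimodal probability distributions $\hat\pi$ and $\pi$ such that $\mathrm{KL}(\hat\pi\mid\pi)<0.9$ and $(m_{\hat\pi}-m_\pi)^2>t\,\sigma_\pi^2$; and (B) there exist one-dimensional, unimodal probability distributions $\hat\pi$ and $\pi$ such that $\mathrm{KL}(\hat\pi\mid\pi)<0.3$ and $(m_{\hat\pi}-m_\pi)^2>t\,\sigma_{\hat\pi}^2$.
   Context: For a probability distribution $\xi$ on $\mathbb{R}$, $m_\xi$ denotes its mean and $\sigma_\xi^2$ its variance. $\mathrm{KL}(\xi\mid\pi)=\int\log\big(\frac{d\xi}{d\pi}\big)d\xi$ is the Kullback--Leibler divergence. *)

(* Defs.v *)
From HB Require Import structures.
From mathcomp Require Import all_boot all_order all_algebra.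
From mathcomp Require Import all_classical all_reals all_analysis.

Set Implicit Arguments.
Unset Strict Implicit.
Unset Printing Implicit Defensive.

Import Order.TTheory GRing.Theory Num.Theory.
Import numFieldNormedType.Exports.

Local Open Scope classical_set_scope.
Local Open Scope ring_scope.
Local Open Scope ereal_scope.

(* The Kullback-Leibler divergence is +oo without absolute continuity.  Where
   the derivative vanishes lne is -oo, but that set is xi-negligible. *)
Definition KL (R : realType) (xi pi : probability (measurableTypeR R) R) : \bar R :=
  if `[< xi `<< pi >] then
    \int[xi]_x lne (Radon_Nikodym (charge_of_finite_measure xi) pi x)
  else +oo.

(* Monotonicity is required only off the mode m, so the density may be
   unbounded near m.  Having a density rules out atoms, in particular the
   degenerate Dirac distributions. *)
Definition unimodal (R : realType) (xi : probability (measurableTypeR R) R) : Prop :=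
  exists (f : R -> R) (m : R),
    [/\ measurable_fun [set: R] f,
        forall x, (0 <= f x)%R,
        forall A, measurable A -> xi A = \int[lebesgue_measure]_(x in A) (f x)%:E,
        forall x y, (x <= y)%R -> (y < m)%R -> (f x <= f y)%R &
        forall x y, (m < x)%R -> (x <= y)%R -> (f y <= f x)%R].

Definition finite_second_moment (R : realType) (xi : probability (measurableTypeR R) R) : Prop :=
  xi.-integrable [set: R] (fun x => (x ^+ 2)%:E).

Definition mean (R : realType) (xi : probability (measurableTypeR R) R) : \bar R :=
  'E_xi[(fun x : R => x)].

Definition var (R : realType) (xi : probability (measurableTypeR R) R) : \bar R :=
  'V_xi[(fun x : R => x)].

(* Main.v *)
(* Mixtures (1 - w) U[0,1] + w U[1,L] are unimodal with mode 1, have mean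
   (1 + w L) / 2 and variance at most 1 + w L^2, and since the two pieces are
   mutually singular the divergence between two of them is the Bernoulli
   divergence KL(w | v) of their weights.
   (A) With L = s^2, w = 1/s and v = 1/s^4, the divergence is at most
   3 ln s / s while the means differ by about s/2 and the variance of the
   v-mixture is at most 2.
   (B) With w = 1/L^2 and v = 1/5, the divergence is at most ln (5/4), the
   means differ by about L/10, and the variance of the w-mixture is at most 2. *)
Require Import Defs.
From HB Require Import structures.
From mathcomp Require Import all_boot all_order all_algebra.
From mathcomp Require Import all_classical all_reals all_analysis.
From mathcomp Require Import measurable_realfun interval_inference ring lra.

Set Implicit Arguments.
Unset Strict Implicit.
Unset Printing Implicit Defensive.

Import Order.TTheory GRing.Theory Num.Theory.
Import numFieldNormedType.Exports.

Local Open Scope classical_set_scope.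
Local Open Scope ring_scope.
Local Open Scope ereal_scope.

(** * Convex mixtures of two probability laws *)

Section mixture.
Context d (T : measurableType d) (R : realType).
Variables (P1 P2 : probability T R) (w : {i01 R}).

Let w_ge0 : (0 <= w%:num :> R)%R. Proof. by []. Qed.

Let onem_w_ge0 : (0 <= 1 - w%:num)%R. Proof. by rewrite subr_ge0. Qed.

(** Built from sums and scalings of measures, so that the measure structure is inherited and only
    the total mass is left to check. *)
Definition mixture : set T -> \bar R :=
  measure_add (mscale (NngNum onem_w_ge0) P1) (mscale (NngNum w_ge0) P2).

HB.instance Definition _ := Measure.on mixture.

Lemma mixtureE A :
  mixture A = (1 - w%:num)%:E * P1 A + (w%:num)%:E * P2 A.
Proof. by rewrite /mixture measure_addE. Qed.

Let mixture_setT : mixture [set: T] = 1.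
Proof. by rewrite mixtureE !probability_setT !mule1 -EFinD subrK. Qed.

HB.instance Definition _ :=
  @Measure_isProbability.Build _ _ R mixture mixture_setT.

Lemma ge0_integral_mixture (f : T -> \bar R) :
    measurable_fun [set: T] f -> (forall x, 0 <= f x) ->
  \int[mixture]_x f x =
    (1 - w%:num)%:E * \int[P1]_x f x + (w%:num)%:E * \int[P2]_x f x.
Proof.
move=> mf f0; rewrite /mixture ge0_integral_measure_add//.
by rewrite !ge0_integral_mscale.
Qed.

End mixture.

(** * Mixtures of mutually singular laws, separated by [D] *)

Section mutually_singular_mixture.
Context d (T : measurableType d) (R : realType).
Variables (P1 P2 : probability T R) (D : set T).
Hypotheses (mD : measurable D) (P1D : P1 (~` D) = 0) (P2D : P2 D = 0).

(** Both the density of one mixture with respect to another and the logarithm of that density have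
    this shape. *)
Definition step (u v : R) (x : T) : R := if x \in D then u else v.

Lemma measurable_step (A : set T) (u v : R) : measurable_fun A (step u v).
Proof using mD.
apply: measurable_funTS; apply: measurable_fun_ifT => //.
apply: (@measurable_fun_bool _ _ _ _ true).
rewrite setTI (_ : _ @^-1` _ = D)//; apply/seteqP; split => x /=.
  by move=> /set_mem.
exact: mem_set.
Qed.

Lemma integral_step (P : probability T R) (A : set T) (u v : R) :
    measurable A ->
  \int[P]_(x in A) (step u v x)%:E =
  u%:E * P (A `&` D) + v%:E * P (A `\` D).
Proof using mD.
move=> mA; rewrite -[in LHS](setUIDK A D) integral_setU//=.
- congr (_ + _).
  + rewrite (eq_integral (cst u%:E)) ?integral_cst//; first exact: measurableI.
    by move=> x /set_mem[_ Dx]; rewrite /step mem_set.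
  + rewrite (eq_integral (cst v%:E)) ?integral_cst//; first exact: measurableD.
    by move=> x /set_mem[_ Dx]; rewrite /step memNset.
- exact: measurableI.
- exact: measurableD.
- exact/measurable_EFinP/measurable_step.
- by apply/disj_setPS => x [[_ ?] []].
Qed.

Lemma measure_split (P : probability T R) A : measurable A ->
  P A = P (A `&` D) + P (A `\` D).
Proof using mD.
move=> mA; rewrite -[in LHS](setUIDK A D) measureU//.
- exact: measurableI.
- exact: measurableD.
- by apply/seteqP; split => x //= [[_ ?] []].
Qed.

Let P1D0 A : measurable A -> P1 (A `\` D) = 0.
Proof.
by move=> mA; apply: (@subset_measure0 _ _ _ P1 _ (~` D)) => //;
  [exact: measurableD|exact: measurableC].
Qed.

Let P2I0 A : measurable A -> P2 (A `&` D) = 0.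
Proof.
by move=> mA; apply: (@subset_measure0 _ _ _ P2 _ D) => //;
  exact: measurableI.
Qed.

(** [P2] does not charge [D] and [P1] lives on it, so cutting with [D] isolates the first component;
    removing [D] isolates the second in the same way. *)
Lemma mixtureI (w : {i01 R}) A : measurable A ->
  mixture P1 P2 w (A `&` D) = (1 - w%:num)%:E * P1 A.
Proof using mD P1D P2D.
move=> mA; rewrite mixtureE P2I0// mule0 adde0 (measure_split P1 mA).
by rewrite P1D0// adde0.
Qed.

Lemma mixtureD (w : {i01 R}) A : measurable A ->
  mixture P1 P2 w (A `\` D) = (w%:num)%:E * P2 A.
Proof using mD P1D P2D.
move=> mA; rewrite mixtureE P1D0// mule0 add0e (measure_split P2 mA).
by rewrite P2I0// add0e.
Qed.

End mutually_singular_mixture.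

(** * Divergence between two singular mixtures *)

Lemma measurable_lne (R : realType) : measurable_fun [set: \bar R] (@lne R).
Proof.
rewrite [X in measurable_fun _ X](_ : _ = fun x : \bar R =>
    if x <= 0 then -oo else er_map (@ln R) x); last first.
  by apply/funext => -[r| |]; rewrite ?lee_fin ?leNye.
apply: measurable_fun_ifT => //.
- apply: (measurable_fun_bool true).
  rewrite setTI (_ : _ @^-1` _ = `]-oo, 0]%classic).
    exact: emeasurable_itv.
  by apply/seteqP; split => x; rewrite /= in_itv.
- exact: (@measurable_er_map _ R R _ (@measurable_ln R)).
Qed.

Section KL_mixture.
Local Open Scope charge_scope.

(** The density is constant on [D] and on its complement, equal to the ratio of the weights there.
    Weights strictly inside the unit interval keep both ratios positive, so their logarithms are
    finite. *)
Lemma KL_mixture (R : realType) (P1 P2 : probability (measurableTypeR R) R)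
    (D : set (measurableTypeR R)) (w v : {i01 R}) :
    measurable D -> P1 (~` D) = 0 -> P2 D = 0 ->
    (0 < w%:num < 1)%R -> (0 < v%:num < 1)%R ->
  KL (mixture P1 P2 w) (mixture P1 P2 v) =
    ((1 - w%:num) * ln ((1 - w%:num) / (1 - v%:num)) +
     w%:num * ln (w%:num / v%:num))%:E.
Proof.
move=> mD P1D P2D /andP[w0 w1] /andP[v0 v1].
pose xi : probability (measurableTypeR R) R := mixture P1 P2 w.
pose pi : probability (measurableTypeR R) R := mixture P1 P2 v.
rewrite -/xi -/pi.
have xiI A : measurable A -> xi (A `&` D) = _ :=
  fun mA => mixtureI mD P1D P2D w mA.
have xiD A : measurable A -> xi (A `\` D) = _ :=
  fun mA => mixtureD mD P1D P2D w mA.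
have piI A : measurable A -> pi (A `&` D) = _ :=
  fun mA => mixtureI mD P1D P2D v mA.
have piD A : measurable A -> pi (A `\` D) = _ :=
  fun mA => mixtureD mD P1D P2D v mA.
set a := (_ / (1 - v%:num))%R; set b := (_ / v%:num)%R.
have a0 : (0 < a)%R by rewrite divr_gt0 ?subr_gt0.
have b0 : (0 < b)%R by rewrite divr_gt0.
(* An explicit density of [xi] with respect to [pi]; absolute continuity follows from it. *)
have xiE A : measurable A -> xi A = \int[pi]_(x in A) (step D a b x)%:E.
  move=> mA; rewrite integral_step// piI// piD//.
  rewrite !muleA -!EFinM !divfK ?gt_eqF ?subr_gt0//.
  exact: mixtureE.
have xipi : xi `<< pi.
  apply/null_content_dominatesP => A mA piA0.
  by rewrite xiE// null_set_integral//; exact/measurable_EFinP/measurable_step.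
rewrite /KL asboolT//.
transitivity (\int[xi]_x (step D (ln a) (ln b) x)%:E); last first.
  rewrite integral_step// xiI// xiD// !probability_setT !mule1.
  by rewrite -!EFinM -EFinD mulrC (mulrC (ln b)).
apply: ae_eq_integral => //.
- apply: measurableT_comp; first exact: measurable_lne.
  by apply: (measurable_int pi); exact: Radon_Nikodym_integrable.
- exact/measurable_EFinP/measurable_step.
(* Densities are unique only up to [pi]-null sets; domination then turns this into equality
   [xi]-almost everywhere, which is what the integral against [xi] needs. *)
have : ae_eq pi setT ('d (charge_of_finite_measure xi) '/d pi)
    (fun x => (step D a b x)%:E).
  apply: integral_ae_eq => //.
  - exact: Radon_Nikodym_integrable.
  - exact/measurable_EFinP/measurable_step.
  - by move=> A _ mA; rewrite -Radon_Nikodym_integral// -xiE.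
move=> /(null_dominates_ae_eq measurableT xipi).
apply: filterS => x /(_ Logic.I) + _ => ->.
by rewrite /step; case: ifPn => _; rewrite lne_EFin.
Qed.

End KL_mixture.

(** * Moments of uniform laws *)

Section uniform_moments.
Context (R : realType) (a b : R).
Hypotheses (ab : (a < b)%R).
Let U := uniform_prob ab : probability (measurableTypeR R) R.

Lemma integral_id_itv :
  \int[lebesgue_measure]_(x in `[a, b]) x%:E = ((b ^+ 2 - a ^+ 2) / 2)%:E.
Proof using ab.
have dsq (x : R) : is_derive x 1%R (fun x : R => x ^+ 2 / 2)%R x.
  have -> : (fun x : R => x ^+ 2 / 2)%R = (fun x => 2^-1 *: (x ^+ 2))%R.
    by apply/funext => y; rewrite mulrC.
  apply: is_derive_eq; rewrite /GRing.scale/=.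
  lra.
have csq : continuous (fun x : R => x ^+ 2 / 2)%R.
  move=> x; apply/differentiable_continuous/derivable1_diffP.
  exact: ex_derive.
rewrite (@continuous_FTC2 _ (fun x : R => x) (fun x => x ^+ 2 / 2)%R)//.
- by rewrite -EFinB -mulrBl.
- by apply: continuous_subspaceT => x.
- split=> [x _||].
  + exact: ex_derive.
  + exact/cvg_at_right_filter/csq.
  + exact/cvg_at_left_filter/csq.
- by move=> x _; rewrite derive1E derive_val.
Qed.

Lemma uniform_integral_le (c : R) (f : R -> R) : measurable_fun setT f ->
  (forall x, 0 <= f x)%R -> (forall x, a <= x <= b -> f x <= c)%R ->
  \int[U]_x (f x)%:E <= c%:E.
Proof.
move=> mf f0 fc; rewrite integral_uniform//; last first.
  exact/measurable_EFinP.
rewrite muleC lee_pdivrMr ?subr_gt0//.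
apply: (@le_trans _ _ (\int[lebesgue_measure]_(x in `[a, b]) (cst c%:E x))).
  apply: ge0_le_integral => //.
  - by move=> x _; rewrite lee_fin.
  - by apply/measurable_EFinP/measurable_funTS.
have -> := integral_cst (@lebesgue_measure R) (measurable_itv `[a, b]) c%:E.
rewrite [X in c%:E * X](_ : _ = (b - a)%:E)//.
by have := @lebesgue_measure_itv R `[a, b]; rewrite /= lte_fin ab.
Qed.

(** The mean is computed through positive and negative parts because integration against a mixture
    is split for nonnegative integrands. When [0 <= a] the identity equals its positive part on the
    support. *)
Lemma uniform_integral_pos (a0 : (0 <= a)%R) :
  \int[U]_x (EFin^\+) x = ((a + b) / 2)%:E.
Proof.
rewrite integral_uniform//; last exact: measurable_funepos.
transitivity ((b - a)^-1%:E * \int[lebesgue_measure]_(x in `[a, b]) x%:E).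
  congr (_ * _); apply: eq_integral => x; rewrite inE/= in_itv/= => /andP[ax _].
  by rewrite funeposE max_l// lee_fin (le_trans a0).
rewrite integral_id_itv -EFinM; congr EFin; field.
by rewrite subr_eq0 gt_eqF.
Qed.

Lemma uniform_integral_neg (a0 : (0 <= a)%R) : \int[U]_x (EFin^\-) x = 0.
Proof.
rewrite integral_uniform//; last exact: measurable_funeneg.
rewrite integral0_eq ?mule0// => x; rewrite /= in_itv/= => /andP[ax _].
by rewrite funenegE max_r// -EFinN lee_fin oppr_le0 (le_trans a0).
Qed.

End uniform_moments.

Lemma measurable_sqr (R : realType) :
  measurable_fun [set: measurableTypeR R] (fun x : R => (x ^+ 2)%:E).
Proof. by apply/measurable_EFinP. Qed.

(** * The two-piece uniform family *)

Section two_step.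
Context (R : realType) (L : R).
Hypothesis (L1 : (1 < L)%R).

(* The mode is [1], where the supports meet: the density is constant on either
   side of it inside the support, whichever piece is higher. *)
Definition two_step (w : {i01 R}) : probability (measurableTypeR R) R :=
  mixture (uniform_prob (@ltr01 R)) (uniform_prob L1) w.

Lemma two_step_unimodal w : unimodal (two_step w).
Proof.
pose f (x : R) :=
  ((1 - w%:num) * uniform_pdf 0 1 x + w%:num * uniform_pdf 1 L x)%R.
have w0 : (0 <= w%:num :> R)%R by [].
have w1 : (0 <= 1 - w%:num :> R)%R by rewrite subr_ge0.
have p1 x : (0 <= uniform_pdf 0 1 x :> R)%R by exact: uniform_pdf_ge0.
have p2 x : (0 <= uniform_pdf 1 L x)%R by exact: uniform_pdf_ge0.
exists f, 1%R; split.
- by apply: measurable_funD; apply: measurable_funM => //;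
    exact: measurable_uniform_pdf.
- by move=> x; rewrite addr_ge0 ?mulr_ge0.
- move=> A mA.
  transitivity (mixture (uniform_prob (@ltr01 R)) (uniform_prob L1) w A) => //.
  rewrite mixtureE /= /uniform_prob.
  have mpdf a b : measurable_fun A
      (fun x : measurableTypeR R => (uniform_pdf a b x : R)%:E).
    by apply/measurable_EFinP/measurable_funTS; exact: measurable_uniform_pdf.
  rewrite -!ge0_integralZl_EFin//; try by move=> x _; rewrite lee_fin.
  rewrite -ge0_integralD//; try by move=> x _; rewrite mule_ge0 ?lee_fin.
  + exact: measurable_funeM.
  + exact: measurable_funeM.
- move=> x y xy y1; rewrite /f /uniform_pdf.
  have -> : (1 <= x)%R = false by lra.
  have -> : (1 <= y)%R = false by lra.
  rewrite /= !mulr0 !addr0 ler_wpM2l//.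
  case: ifPn => [/andP[x0 x1]|_]; case: ifPn => //.
  by rewrite negb_and; lra.
- move=> x y x1 xy; rewrite /f /uniform_pdf.
  have -> : (x <= 1)%R = false by lra.
  have -> : (y <= 1)%R = false by lra.
  rewrite !andbF /= !mulr0 !add0r ler_wpM2l//.
  case: ifPn => [/andP[y1 yL]|_]; case: ifPn => //.
    by rewrite negb_and; lra.
  by move=> _; rewrite invr_ge0 subr_ge0 ltW.
Qed.

(** The square is at most [1] on the first support and at most [L ^+ 2] on the second. *)
Lemma two_step_integral_sqr w :
  \int[two_step w]_x (x ^+ 2)%:E <= (1 + w%:num * L ^+ 2)%:E.
Proof.
rewrite ge0_integral_mixture//; last 2 first.
- exact: measurable_sqr.
- by move=> x; rewrite lee_fin sqr_ge0.
rewrite [leRHS](_ : _ = 1 + (w%:num)%:E * (L ^+ 2)%:E) ?leeD//.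
- apply: (@le_trans _ _ ((1 - w%:num)%:E * 1)).
    apply: lee_wpmul2l; first by rewrite lee_fin subr_ge0.
    apply: uniform_integral_le => //.
    + by move=> x; exact: sqr_ge0.
    + by move=> x x01; nra.
  by rewrite mule1 lee_fin lerBlDr lerDl.
- apply: lee_wpmul2l; first by rewrite lee_fin.
  apply: uniform_integral_le => //.
  + by move=> x; exact: sqr_ge0.
  + by move=> x x1L; nra.
Qed.

Lemma two_step_finite_second_moment w : finite_second_moment (two_step w).
Proof.
apply/integrableP; split; first exact: measurable_sqr.
apply: (@le_lt_trans _ _ (\int[two_step w]_x (x ^+ 2)%:E)); last first.
  exact: le_lt_trans (two_step_integral_sqr w) (ltry _).
rewrite le_eqVlt; apply/orP; left; apply/eqP.
by apply: eq_integral => x _; rewrite gee0_abs ?lee_fin ?sqr_ge0.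
Qed.

Lemma two_step_mean w : mean (two_step w) = ((1 + w%:num * L) / 2)%:E.
Proof.
rewrite /mean unlock integralE.
have m : measurable_fun [set: measurableTypeR R] (EFin : R -> \bar R).
  exact/measurable_EFinP.
rewrite !ge0_integral_mixture//;
  [|exact: measurable_funeneg|exact: measurable_funepos].
rewrite !uniform_integral_neg// !uniform_integral_pos//.
rewrite !mule0 adde0 sube0 -!EFinM -EFinD; congr EFin.
lra.
Qed.

(** Square integrability, in the form required to write the variance as the second moment minus the
    squared mean. *)
Lemma two_step_Lfun2 w : (fun x : R => x) \in Lfun (two_step w) 2%:E.
Proof.
rewrite inE; apply/andP; split; rewrite inE//=.
rewrite /finite_norm unlock /Lnorm/= poweR_lty//.
apply: (@le_lt_trans _ _ (\int[two_step w]_x (x ^+ 2)%:E)); last first.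
  exact: le_lt_trans (two_step_integral_sqr w) (ltry _).
rewrite le_eqVlt; apply/orP; left; apply/eqP.
by apply: eq_integral => x _; rewrite powR_mulrn// real_normK// num_real.
Qed.

Lemma two_step_var w : var (two_step w) <= (1 + w%:num * L ^+ 2)%:E.
Proof.
rewrite /var varianceE ?two_step_Lfun2//.
rewrite -/(mean _) two_step_mean.
apply: le_trans (two_step_integral_sqr w).
rewrite unlock.
rewrite leeBlDr// leeDl//.
by rewrite lee_fin sqr_ge0.
Qed.

Lemma KL_two_step (w v : {i01 R}) :
    (0 < w%:num < 1)%R -> (0 < v%:num < 1)%R ->
  KL (two_step w) (two_step v) =
    ((1 - w%:num) * ln ((1 - w%:num) / (1 - v%:num)) +
     w%:num * ln (w%:num / v%:num))%:E.
Proof.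
move=> w01 v01; apply: (KL_mixture (measurable_itv `]-oo, 1%R])) => //.
- rewrite /= /uniform_prob integral0_eq// => x /=.
  rewrite in_itv/= /uniform_pdf => /negP; rewrite -ltNge => x1.
  by rewrite (leNgt x) x1 andbF.
(* The density on [[1, L]] is positive at [1], so that Lebesgue-null endpoint is dropped first; on
   the open half-line the density vanishes. *)
- rewrite /= /uniform_prob -integral_itv_bndo_bndc.
    rewrite integral0_eq// => x /=.
    by rewrite in_itv/= /uniform_pdf => x1; rewrite leNgt x1.
  by apply/measurable_EFinP/measurable_funTS; exact: measurable_uniform_pdf.
Qed.

End two_step.

Lemma two_step_mean_gap (R : realType) (L : R) (L1 : (1 < L)%R)
    (w v : {i01 R}) :
  (mean (two_step L1 w) - mean (two_step L1 v)) ^+ 2 =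
    (((w%:num - v%:num) * L / 2) ^+ 2)%:E.
Proof.
rewrite !two_step_mean -EFinB -EFin_expe; congr (_ ^+ 2)%:E.
by field.
Qed.

Lemma two_step_var_lt (R : realType) (L : R) (L1 : (1 < L)%R) (w : {i01 R})
    (t c : R) :
  (w%:num * L ^+ 2 <= 1)%R -> (0 < t)%R -> (2 * t < c)%R ->
  t%:E * var (two_step L1 w) < c%:E.
Proof.
move=> wL t0 tc; apply: (@le_lt_trans _ _ (t%:E * 2%:E)).
  apply: lee_wpmul2l; first by rewrite lee_fin ltW.
  by apply: le_trans (two_step_var L1 w) _; rewrite lee_fin; lra.
by rewrite -EFinM lte_fin mulrC.
Qed.

(** * Choice of parameters *)

Theorem proposition3p1 (R : realType) (t : R) (ht : (0 < t)%R) :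
  (exists pihat pi : probability (measurableTypeR R) R,
    [/\ unimodal pihat /\ unimodal pi,
        finite_second_moment pihat /\ finite_second_moment pi,
        KL pihat pi < (9 / 10)%:E &
        (mean pihat - mean pi) ^+ 2 > t%:E * var pi])
  /\
  (exists pihat pi : probability (measurableTypeR R) R,
    [/\ unimodal pihat /\ unimodal pi,
        finite_second_moment pihat /\ finite_second_moment pi,
        KL pihat pi < (3 / 10)%:E &
        (mean pihat - mean pi) ^+ 2 > t%:E * var pihat]).
Proof.
split.
(* Taking [s] to be a square turns the dominant logarithm into [6 * ln r], which is below [6 * r];
   divided by [s] this leaves [6 / r], and [7 < r] brings it under [6 / 7], hence under [9 / 10]. *)
- pose r := (t + 7)%R; pose s := (r ^+ 2)%R; pose L := (s ^+ 2)%R.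
  have r7 : (7 < r)%R by rewrite /r; lra.
  have s49 : (49 + 14 * t < s)%R by rewrite /s /r; nra.
  have L1 : (1 < L)%R by rewrite /L; nra.
  have sV : (s^-1 * s = 1)%R by rewrite mulVf// gt_eqF//; lra.
  have w0 : (0 < s^-1)%R by rewrite invr_gt0; lra.
  have w1 : (s^-1 < 1)%R by nra.
  have v0 : (0 < s^-1 ^+ 4)%R by rewrite exprn_gt0.
  have vw : (s^-1 ^+ 4 < s^-1)%R.
    by rewrite exprS gtr_pMr//; apply: exprn_ilt1 => //; exact: ltW.
  pose w := Itv01 (ltW w0) (ltW w1).
  pose v := Itv01 (ltW v0) (ltW (lt_trans vw w1)).
  exists (two_step L1 w), (two_step L1 v); split.
  + by split; exact: two_step_unimodal.
  + by split; exact: two_step_finite_second_moment.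
  + rewrite KL_two_step /= ?w0 ?v0//; last by rewrite (lt_trans vw).
    rewrite lte_fin.
    (* The first weight of [pihat] is the smaller one since [v < w], so this term can only help. *)
    have h1 : ((1 - s^-1) * ln ((1 - s^-1) / (1 - s^-1 ^+ 4)) <= 0)%R.
      rewrite mulr_ge0_le0 ?subr_ge0 ?(ltW w1)// ln_le0//.
      by rewrite ler_pdivrMr; lra.
    have -> : (s^-1 / s^-1 ^+ 4 = r ^+ 6)%R.
      by rewrite /s; field; lra.
    have h2 : (ln (r ^+ 6) < 6 * r)%R.
      rewrite lnXn ?(lt_trans _ r7)// -[(ln r *+ 6)%R]mulr_natl ltr_pM2l//.
      by apply: ln_sublinear; lra.
    have h3 : (s^-1 * ln (r ^+ 6) < s^-1 * (6 * r))%R by rewrite ltr_pM2l.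
    have h4 : (s^-1 * (6 * r) <= 6 / 7)%R.
      by rewrite mulrC ler_pdivrMr /s; nra.
    lra.
  + rewrite two_step_mean_gap; apply: two_step_var_lt => //=.
      have -> : (s^-1 ^+ 4 * L ^+ 2 = (s^-1 * s) ^+ 4)%R by rewrite /L; ring.
      by rewrite sV expr1n.
    have -> : ((s^-1 - s^-1 ^+ 4) * L / 2 = (s - s^-1 ^+ 2) / 2)%R.
      by rewrite /L; field; lra.
    (* The gap exceeds [(s - 1) / 2], hence [24 + 7 * t], and its square beats [2 * t]. *)
    have q1 : (s^-1 ^+ 2 < 1)%R by rewrite exprn_ilt1// ltW.
    nra.
(* A generous size: [L / 5] is [4 * (t + 1)] while [L^-1] stays below [1 / 20], so the squared mean
   gap exceeds [2 * t]. *)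
- pose L := (20 * (t + 1))%R.
  have L20 : (20 < L)%R by rewrite /L; lra.
  have L1 : (1 < L)%R by lra.
  have LV : (L^-1 * L = 1)%R by rewrite mulVf// gt_eqF//; lra.
  have l0 : (0 < L^-1)%R by rewrite invr_gt0; lra.
  have l20 : (L^-1 < 1 / 20)%R by nra.
  have w0 : (0 < L^-1 ^+ 2)%R by rewrite exprn_gt0.
  have w5 : (L^-1 ^+ 2 < 1 / 5)%R by nra.
  have w1 : (L^-1 ^+ 2 < 1)%R by lra.
  have v0 : (0 < 1 / 5 :> R)%R by lra.
  have v1 : (1 / 5 < 1 :> R)%R by lra.
  pose w := Itv01 (ltW w0) (ltW w1).
  pose v := Itv01 (ltW v0) (ltW v1).
  exists (two_step L1 w), (two_step L1 v); split.
  + by split; exact: two_step_unimodal.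
  + by split; exact: two_step_finite_second_moment.
  + rewrite KL_two_step /= ?w0 ?v0// lte_fin.
    clear w v; set W := (L^-1 ^+ 2)%R in w0 w5 w1 *.
    have h1 : (W * ln (W / (1 / 5)) <= 0)%R.
      rewrite mulr_ge0_le0 ?(ltW w0)// ln_le0//.
      by rewrite ler_pdivrMr; lra.
    (* The ratio is at most [5 / 4], and [ln (1 + x) <= x] gives [1 / 4], under the allowed
       [3 / 10]. *)
    have h2 : (ln ((1 - W) / (1 - 1 / 5)) <= 1 / 4)%R.
      have -> : ((1 - W) / (1 - 1 / 5) = 1 + (1 / 4 - 5 / 4 * W))%R.
        by field; lra.
      by apply: le_trans (le_ln1Dx _) _; lra.
    nra.
  + rewrite two_step_mean_gap; apply: two_step_var_lt => //=.
      by rewrite -exprMn LV expr1n.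
    have -> : ((L^-1 ^+ 2 - 1 / 5) * L / 2 = (L^-1 - L / 5) / 2)%R.
      by field; lra.
    rewrite /L in l20 *; nra.
Qed.
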